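(* If the representation $W_{\mathbf{L},\mathbf{K}}$ is generic, then $\Psi_{\mathbf{L},\mathbf{K}}\big(\mathbb{P}(W_{\mathbf{L},\mathbf{K}})\big)=\Phi_{\mathbf{L},\mathbf{K}}\big(\mathbb{P}(W_{\mathbf{L},\mathbf{K}})\big)\cap\mathfrak{t}$.
   Context: $G=U(2)$, $\mathfrak{g}=\mathfrak{u}(2)$ is the space of $2\times 2$ skew-Hermitian matrices, $T\le G$ the torus of diagonal matrices, and $\mathfrak{t}\subset\mathfrak{g}$ the diagonal skew-Hermitian matrices. For $k\ge 0$ write points of $\mathbb{C}^{k+1}$ as $Z=(z_0,\ldots,z_k)^t$ and set $F_{k,1}(Z):=\left(\sqrt{k-j+1}\,z_{j-1}\right)_{j=1}^k$, $F_{k,2}(Z):=\left(\sqrt{j}\,z_j\right)_{j=1}^k$ in $\mathbb{C}^k$ (these are $0$ if $k=0$). Let $r\ge 1$, $\mathbf{L}=(l_a)\in\mathbb{Z}^r$, $\mathbf{K}=(k_a)\in\mathbb{N}^r$, and $W_{\mathbf{L},\mathbf{K}}=\bigoplus_{a=1}^r\det^{\otimes l_a}\otimes\mathrm{Sym}^{k_a}(\mathbb{C}^2)\cong\bigoplus_{a=1}^r\mathbb{C}^{k_a+1}$ (composed with the automorphism $B\mapsto(B^t)^{-1}$ of $G$). Write $Z=(Z_a)_{a=1}^r$ with $Z_a\in\mathbb{C}^{k_a+1}$. The moment map (with respect to twice the Fubini-Study form) of the $G$-action on $\mathbb{P}(W_{\mathbf{L},\mathbf{K}})$ is $\Phi_{\mathbf{L},\mathbf{K}}:\mathbb{P}(W_{\mathbf{L},\mathbf{K}})\to\mathfrak{g}$,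 $$\Phi_{\mathbf{L},\mathbf{K}}([Z])=\frac{\imath}{\|Z\|^2}\sum_{a=1}^r\begin{pmatrix}\|F_{k_a,1}(Z_a)\|^2+l_a\|Z_a\|^2& F_{k_a,2}(Z_a)^t\,\overline{F_{k_a,1}(Z_a)}\\ F_{k_a,1}(Z_a)^t\,\overline{F_{k_a,2}(Z_a)}&\|F_{k_a,2}(Z_a)\|^2+l_a\|Z_a\|^2\end{pmatrix},$$ and the moment map $\Psi_{\mathbf{L},\mathbf{K}}:\mathbb{P}(W_{\mathbf{L},\mathbf{K}})\to\mathfrak{t}$ of the $T$-action is the diagonal part of $\Phi_{\mathbf{L},\mathbf{K}}$. The representation $W_{\mathbf{L},\mathbf{K}}$ is called generic if, whenever for some $l\in\mathbb{Z}$ the pair $(l,1)$ appears in the sequence $(l_1,k_1),\ldots,(l_r,k_r)$, there are $1\le a<b\le r$ with $(l_a,k_a)=(l_b,k_b)=(l,1)$. *)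

(* Defs.v *)
From HB Require Import structures.
From mathcomp Require Import all_boot all_order all_algebra.
From mathcomp Require Import complex.
From mathcomp Require Import classical_sets reals.

Set Implicit Arguments.
Unset Strict Implicit.
Unset Printing Implicit Defensive.

Import GRing.Theory Num.Theory.
Local Open Scope ring_scope.
Local Open Scope classical_set_scope.

Section ProjectiveSpace.
Variables (F : fieldType) (V : vectType F).

Definition proj_space : Type := {D : {vspace V} | \dim D == 1%N}.

Lemma dim_line (v : V) : v != 0 -> \dim <[v]>%VS == 1%N.
Proof. by move=> v0; rewrite dim_vline v0. Qed.

Definition proj_class (v : V) (v0 : v != 0) : proj_space :=
  exist _ <[v]>%VS (dim_line v0).

(* Homogeneous coordinates of a point, chosen arbitrarily. *)
Definition repr_vec (p : proj_space) : V := vpick (sval p).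

Lemma repr_vec_neq0 (p : proj_space) : repr_vec p != 0.
Proof. by case: p => D dD; rewrite /repr_vec vpick0 -dimv_eq0 /= (eqP dD). Qed.

Lemma proj_class_repr (p : proj_space) : proj_class (repr_vec_neq0 p) = p.
Proof.
apply: val_inj => /=; apply/eqP; rewrite eqEdim.
rewrite -memvE memv_pick (eqP (valP p)) dim_vline.
by have -> := repr_vec_neq0 p.
Qed.

Lemma repr_vec_class (v : V) (v0 : v != 0) :
  exists2 c : F, c != 0 & repr_vec (proj_class v0) = c *: v.
Proof.
have /vlineP[c cE] : repr_vec (proj_class v0) \in <[v]>%VS by exact: memv_pick.
exists c => //; apply: contra_neq (repr_vec_neq0 (proj_class v0)) => c0.
by rewrite cE c0 scale0r.
Qed.

End ProjectiveSpace.

Section MomentMaps.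
Variable R : realType.
Local Notation C := R[i].

(* The library norm on column vectors is the sup norm; this is the square of
   the Hermitian norm. *)
Definition sqnorm n (v : 'cV[C]_n) : C := \sum_(i < n) `|v i 0| ^+ 2.

Definition conj_mx m n (A : 'M[C]_(m, n)) : 'M[C]_(m, n) := map_mx Num.conj A.

Definition u2 : set 'M[C]_2 := [set A | conj_mx A^T = - A].

Definition t2 : set 'M[C]_2 := [set A | u2 A /\ is_diag_mx A].

(* The index j of 'I_k stands for j.+1 in the range 1, ..., k: the coefficients
   sqrt (k - j + 1) and sqrt j of z_(j-1) and z_j become sqrt (k - j) and
   sqrt j.+1, with coordinates z_j and z_(j.+1). *)
Definition F1 k (z : 'cV[C]_k.+1) : 'cV[C]_k :=
  \col_(j < k) (sqrtC (k - j)%:R * z (widen_ord (leqnSn k) j) 0).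

Definition F2 k (z : 'cV[C]_k.+1) : 'cV[C]_k :=
  \col_(j < k) (sqrtC j.+1%:R * z (lift ord0 j) 0).

Section Rep.
Variables (r : nat) (L : 'I_r -> int) (K : 'I_r -> nat).

(* The space of W_(L,K) is the direct sum of the C^(k_a + 1), as block columns;
   the component Z_a is submxcol Z a. *)
Definition Wspace := 'cV[C]_(\sum_(a < r) (K a).+1).

Definition Phi_block (a : 'I_r) (z : 'cV[C]_(K a).+1) : 'M[C]_2 :=
  block_mx
    (sqnorm (F1 z) + (L a)%:~R * sqnorm z)%:M ((F2 z)^T *m conj_mx (F1 z))
    ((F1 z)^T *m conj_mx (F2 z)) (sqnorm (F2 z) + (L a)%:~R * sqnorm z)%:M
  : 'M[C]_(1 + 1).

Definition Phi_hom (Z : Wspace) : 'M[C]_2 :=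
  ('i%R / sqnorm Z) *: \sum_(a < r) Phi_block (submxcol Z a).

Definition Phi (p : proj_space Wspace) : 'M[C]_2 := Phi_hom (repr_vec p).

Definition Psi (p : proj_space Wspace) : 'M[C]_2 :=
  diag_mx (\row_i Phi p i i).

Definition generic_rep : Prop :=
  forall l : int, (exists a : 'I_r, (L a, K a) = (l, 1%N)) ->
  exists a b : 'I_r,
    [/\ (a < b)%N, (L a, K a) = (l, 1%N) & (L b, K b) = (l, 1%N)].

End Rep.

Lemma sqnormZ n (c : C) (v : 'cV[C]_n) : sqnorm (c *: v) = `|c| ^+ 2 * sqnorm v.
Proof.
by rewrite /sqnorm mulr_sumr; apply: eq_bigr => i _; rewrite mxE normrM exprMn.
Qed.

Fact trmx_scale m n (c : C) (A : 'M[C]_(m, n)) : (c *: A)^T = c *: A^T.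
Proof. by apply/matrixP=> i j; rewrite !mxE. Qed.

Lemma F1Z k c (z : 'cV[C]_k.+1) : F1 (c *: z) = c *: F1 z.
Proof. by apply/matrixP=> i j; rewrite !mxE mulrCA. Qed.

Lemma F2Z k c (z : 'cV[C]_k.+1) : F2 (c *: z) = c *: F2 z.
Proof. by apply/matrixP=> i j; rewrite !mxE mulrCA. Qed.

Lemma mulmx_conjZ k c (u v : 'cV[C]_k) :
  (c *: u)^T *m conj_mx (c *: v) = `|c| ^+ 2 *: (u^T *m conj_mx v).
Proof.
by rewrite /conj_mx map_mxZ trmx_scale -scalemxAl -scalemxAr scalerA normCK.
Qed.

Lemma Phi_homZ r (L : 'I_r -> int) (K : 'I_r -> nat) c (Z : Wspace K) :
  c != 0 -> Phi_hom L (c *: Z) = Phi_hom L Z.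
Proof.
move=> c0; have n0 : `|c| ^+ 2 != 0 by rewrite expf_neq0 ?normr_eq0.
rewrite /Phi_hom.
have -> : \sum_(a < r) Phi_block L (submxcol (c *: Z) a) =
          `|c| ^+ 2 *: \sum_(a < r) Phi_block L (submxcol Z a).
  rewrite scaler_sumr; apply: eq_bigr => a _.
  have -> : submxcol (c *: Z) a = c *: submxcol Z a.
    by apply/matrixP=> i j; rewrite !mxE.
  rewrite /Phi_block F1Z F2Z !sqnormZ !mulmx_conjZ.
  rewrite [RHS](@scale_block_mx C 1 1 1 1).
  by rewrite !scale_scalar_mx !mulrDr ![_%:~R * (_ * _)]mulrCA.
by rewrite sqnormZ scalerA invfM [_^-1 * _^-1]mulrC -!mulrA mulVf // mulr1.
Qed.

(* Phi is given by the formula in arbitrary homogeneous coordinates. *)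
Lemma Phi_class r (L : 'I_r -> int) (K : 'I_r -> nat) (Z : Wspace K)
  (Z0 : Z != 0) : Phi L (proj_class Z0) = Phi_hom L Z.
Proof.
rewrite /Phi; have [c c0 ->] := repr_vec_class Z0.
exact: Phi_homZ.
Qed.

Lemma conj_sqnorm n (v : 'cV[C]_n) : Num.conj (sqnorm v) = sqnorm v.
Proof. by apply: conj_Creal; apply: ger0_real; apply: sumr_ge0 => i _; rewrite exprn_ge0. Qed.

Lemma conj_mxK m n (A : 'M[C]_(m, n)) : conj_mx (conj_mx A) = A.
Proof. by apply/matrixP=> i j; rewrite !mxE conjCK. Qed.

Lemma Phi_block_herm r (L : 'I_r -> int) (K : 'I_r -> nat) a
  (z : 'cV[C]_(K a).+1) : conj_mx (Phi_block L z)^T = Phi_block L z.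
Proof.
have cs (s t : C) (l : int) : Num.conj s = s -> Num.conj t = t ->
    (map_mx Num.conj (s + l%:~R * t)%:M : 'M[C]_1) = (s + l%:~R * t)%:M.
  by move=> es et; rewrite map_scalar_mx rmorphD rmorphM rmorph_int /= es et.
rewrite /Phi_block /conj_mx (@tr_block_mx C 1 1 1 1) (@map_block_mx C C _ 1 1 1 1) !tr_scalar_mx.
rewrite !cs ?conj_sqnorm // !trmx_mul !trmxK !map_mxM !map_trmx.
by rewrite -!/(conj_mx _) !conj_mxK.
Qed.

Lemma Phi_in_u2 r (L : 'I_r -> int) (K : 'I_r -> nat)
  (p : proj_space (Wspace K)) : u2 (Phi L p).
Proof.
rewrite /u2 /= /Phi /Phi_hom /conj_mx trmx_scale map_mxZ raddf_sum raddf_sum /=.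
rewrite rmorphM fmorphV /= conj_sqnorm conjCi mulNr scaleNr.
by congr (- (_ *: _)); apply: eq_bigr => a _; apply: Phi_block_herm.
Qed.

Lemma Psi_in_t2 r (L : 'I_r -> int) (K : 'I_r -> nat)
  (p : proj_space (Wspace K)) : t2 (Psi L p).
Proof.
split; last exact: diag_mx_is_diag.
rewrite /u2 /= /Psi tr_diag_mx /conj_mx map_diag_mx -raddfN; congr diag_mx.
apply/rowP=> i; have /matrixP/(_ i i) := Phi_in_u2 L p.
by rewrite !mxE.
Qed.

End MomentMaps.

(* Main.v *)
(** The diagonal of the moment map is the barycentre of the weights
    (k_a - j + l_a, j + l_a) for the masses |z_(a,j)|^2, so it is unchanged when
    each mass is pushed, in proportions preserving the mean, to the two extreme
    weights j = 0 and j = k_a of its summand.  The off-diagonal entry only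
    involves products of consecutive coordinates, so it then vanishes unless
    k_a = 1; in that case genericity allows the two extreme weights to be carried
    by two different copies of the summand. *)
Require Import Defs.
From mathcomp Require Import all_boot all_order all_algebra.
From mathcomp Require Import complex ring.
From mathcomp Require Import classical_sets reals.

Set Implicit Arguments.
Unset Strict Implicit.
Unset Printing Implicit Defensive.

Import Order.TTheory GRing.Theory Num.Theory.
Local Open Scope ring_scope.
Local Open Scope classical_set_scope.

Section HermitianNorm.
Variable R : realType.
Local Notation C := R[i].

Lemma sqnorm_eq0 n (v : 'cV[C]_n) : (sqnorm v == 0) = (v == 0).
Proof.
apply/eqP/eqP => [v0|->]; last first.
  by rewrite /sqnorm big1 // => i _; rewrite mxE normr0 expr0n.
apply/colP => i; rewrite mxE.
have /psumr_eq0P := v0 => /(_ (fun i _ => exprn_ge0 _ (normr_ge0 _))) /(_ i isT).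
by move/eqP; rewrite expf_eq0 normr_eq0 => /andP[_ /eqP].
Qed.

Lemma sqnorm_submxcol r (K : 'I_r -> nat) (Z : @Wspace R r K) :
  sqnorm Z = \sum_a sqnorm (submxcol Z a).
Proof.
(* Written as the product of a row and a column, the norm splits over blocks by block
   multiplication. *)
have sqE n (v : 'cV[C]_n) : sqnorm v = (v^T *m conj_mx v) 0 0.
  by rewrite mxE; apply: eq_bigr => i _; rewrite !mxE normCK.
rewrite sqE -[Z in LHS]submxcolK tr_mxcol /conj_mx.
have -> : map_mx Num.conj (\mxcol_a submxcol Z a) =
          \mxcol_a map_mx Num.conj (submxcol Z a).
  by apply/matrixP => i j; rewrite !mxE.
rewrite mul_mxrow_mxcol summxE; apply: eq_bigr => a _.
by rewrite sqE.
Qed.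

(** The coefficient [k - j] vanishes at [j = k], so the sum over [k] indices extends to all [k + 1]
    coordinates. *)
Lemma sqnorm_F1 k (z : 'cV[C]_k.+1) :
  sqnorm (F1 z) = \sum_(j < k.+1) (k%:R - j%:R) * `|z j 0| ^+ 2.
Proof.
rewrite big_ord_recr /= subrr mul0r addr0; apply: eq_bigr => j _.
rewrite !mxE normrM exprMn -normrX sqrtCK normr_nat natrB 1?ltnW //.
Qed.

Lemma sqnorm_F2 k (z : 'cV[C]_k.+1) :
  sqnorm (F2 z) = \sum_(j < k.+1) j%:R * `|z j 0| ^+ 2.
Proof.
rewrite big_ord_recl /= mul0r add0r; apply: eq_bigr => j _.
by rewrite !mxE normrM exprMn -normrX sqrtCK normr_nat.
Qed.

End HermitianNorm.

Section PhiEntries.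
Variables (R : realType) (r : nat) (L : 'I_r -> int) (K : 'I_r -> nat).
Local Notation C := R[i].

Let i0 : 'I_(1 + 1) := lshift 1 0.
Let i1 : 'I_(1 + 1) := rshift 1 0.

(** The weight is put in the affine form [x a + y a * j] to which [push_sum] applies, here with
    slope [-1]. *)
Lemma Phi_block00 a (z : 'cV[C]_(K a).+1) :
  Phi_block L z i0 i0 =
  \sum_(j < (K a).+1) ((K a)%:R + (L a)%:~R + -1 * j%:R) * `|z j 0| ^+ 2.
Proof.
rewrite /Phi_block (@block_mxEul C 1 1 1 1) mxE eqxx mulr1n sqnorm_F1.
rewrite /sqnorm mulr_sumr -big_split; apply: eq_bigr => j _ /=; ring.
Qed.

Lemma Phi_block11 a (z : 'cV[C]_(K a).+1) :
  Phi_block L z i1 i1 =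
  \sum_(j < (K a).+1) ((L a)%:~R + 1 * j%:R) * `|z j 0| ^+ 2.
Proof.
rewrite /Phi_block (@block_mxEdr C 1 1 1 1) mxE eqxx mulr1n sqnorm_F2.
rewrite /sqnorm mulr_sumr -big_split; apply: eq_bigr => j _ /=; ring.
Qed.

Lemma Phi_block_diag a (z : 'cV[C]_(K a).+1) :
    (forall j : 'I_(K a),
      z (widen_ord (leqnSn (K a)) j) 0 * z (lift ord0 j) 0 = 0) ->
  is_diag_mx (Phi_block L z).
Proof.
move=> zz; have zz0 j :
    z (widen_ord (leqnSn (K a)) j) 0 = 0 \/ z (lift ord0 j) 0 = 0.
  by have /eqP := zz j; rewrite mulf_eq0 => /orP[] /eqP; auto.
apply/is_diag_mxP => i j; rewrite /Phi_block.
case: (@split_ordP 1 1 i) => i' ->; case: (@split_ordP 1 1 j) => j' ->;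
  rewrite !ord1 ?eqxx // => _.
- rewrite (@block_mxEur C 1 1 1 1) mxE big1 // => k _; rewrite !mxE.
  by case: (zz0 k) => ->; rewrite ?mulr0 ?rmorph0 ?mul0r ?mulr0.
- rewrite (@block_mxEdl C 1 1 1 1) mxE big1 // => k _; rewrite !mxE.
  by case: (zz0 k) => ->; rewrite ?mulr0 ?rmorph0 ?mul0r ?mulr0.
Qed.

End PhiEntries.

Section Pushing.
Variables (F : numFieldType) (r : nat) (K : 'I_r -> nat) (r0 r1 : 'I_r -> 'I_r).

(* [j%:R / (K a)%:R] is the proportion of the mass at [j] sent to the upper end;
   for [K a = 0] it is [0 / 0 = 0], so that the mass stays at [j = 0]. *)
Definition upper_mass (P : forall a, 'I_(K a).+1 -> F) a : F :=
  \sum_(j < (K a).+1) j%:R / (K a)%:R * P a j.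

Definition lower_mass (P : forall a, 'I_(K a).+1 -> F) a : F :=
  \sum_(j < (K a).+1) (1 - j%:R / (K a)%:R) * P a j.

(** The maps [r0] and [r1] choose the summands that receive the lower and upper mass of each [b].
    When [K a = 0] the two ends coincide and both terms count. *)
Definition push (P : forall a, 'I_(K a).+1 -> F) a (j : 'I_(K a).+1) : F :=
  (j == 0 :> nat)%:R * (\sum_(b | r0 b == a) lower_mass P b) +
  (j == K a :> nat)%:R * (\sum_(b | r1 b == a) upper_mass P b).

Lemma push_ge0 (P : forall a, 'I_(K a).+1 -> F) :
  (forall a j, 0 <= P a j) -> forall a (j : 'I_(K a).+1), 0 <= push P j.
Proof.
move=> P0 a j.
have le1 b (i : 'I_(K b).+1) : (i%:R / (K b)%:R : F) <= 1.
  have [K0|K0] := posnP (K b); first by rewrite [in X in _ / X]K0 invr0 mulr0 ler01.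
  by rewrite ler_pdivrMr ?ltr0n // mul1r ler_nat -ltnS.
by rewrite addr_ge0 // mulr_ge0 // sumr_ge0 // => b _; rewrite sumr_ge0 // => i _;
  rewrite mulr_ge0 // ?subr_ge0 // divr_ge0.
Qed.

(** An affine function of [j] is the mean of its values at [0] and [K a] with proportions
    [1 - j / K a] and [j / K a]. At the lower end its value is [x a]; at the upper end it also
    involves [y a] and [K a], which [r1] must therefore preserve. *)
Lemma push_sum (P : forall a, 'I_(K a).+1 -> F) (x y : 'I_r -> F) :
    (forall a, x (r0 a) = x a) -> (forall a, x (r1 a) = x a) ->
    (forall a, y (r1 a) = y a) -> (forall a, K (r1 a) = K a) ->
  \sum_a \sum_(j < (K a).+1) (x a + y a * j%:R) * push P j =
  \sum_a \sum_(j < (K a).+1) (x a + y a * j%:R) * P a j.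
Proof.
move=> x0 x1 y1 K1.
have ends (u v : F) a :
    \sum_(j < (K a).+1) (x a + y a * j%:R) *
      ((j == 0 :> nat)%:R * u + (j == K a :> nat)%:R * v) =
    x a * u + (x a + y a * (K a)%:R) * v.
  under eq_bigr => j _ do rewrite mulrDr.
  rewrite big_split /=; congr (_ + _).
    rewrite (bigD1 ord0) //= big1 => [|j]; last first.
      by rewrite -val_eqE => /negPf /= ->; rewrite mul0r mulr0.
    by rewrite mulr0 !addr0 mul1r.
  rewrite (bigD1 ord_max) //= big1 => [|j]; last first.
    by rewrite -val_eqE => /negPf /= ->; rewrite mul0r mulr0.
  by rewrite eqxx mul1r addr0.
have inner a : \sum_(j < (K a).+1) (x a + y a * j%:R) * push P j =
    \sum_(b | r0 b == a) x b * lower_mass P b +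
    \sum_(b | r1 b == a) (x b + y b * (K b)%:R) * upper_mass P b.
  rewrite ends !mulr_sumr; congr (_ + _); apply: eq_bigr => b /eqP <-.
    by rewrite x0.
  by rewrite x1 y1 K1.
under eq_bigr => a _ do rewrite inner.
rewrite big_split /=.
(* The sums grouped by receiving summand become sums over the summand of origin. *)
rewrite -(partition_big r0 xpredT (P := xpredT)) //.
rewrite -(partition_big r1 xpredT (P := xpredT)) //.
rewrite -big_split; apply: eq_bigr => a _ /=.
rewrite !mulr_sumr -big_split; apply: eq_bigr => j _ /=.
(* This survives [K a = 0], where the only index is [j = 0]. *)
have jE : (K a)%:R * (j%:R / (K a)%:R) = j%:R :> F.
  have [K0|K0] := posnP (K a); last by rewrite mulrC divfK // pnatr_eq0 -lt0n.
  by case: j => -[|j] jK /=; rewrite ?mul0r ?mulr0 //; rewrite K0 in jK.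
rewrite -[in RHS]jE; ring.
Qed.

(** The first factor can be nonzero only if [j = 0], the second only if [j + 1 = K a]. Together
    these force [K a = 1], and then [a] does not receive both kinds of mass. *)
Lemma push_consecutive (P : forall a, 'I_(K a).+1 -> F) a (j : 'I_(K a)) :
    (K a = 1 -> forall b c, r0 b = a -> r1 c = a -> False) ->
  push P (widen_ord (leqnSn (K a)) j) * push P (lift ord0 j) = 0.
Proof.
move=> disj; rewrite /push /= /bump /= add1n (ltn_eqF (ltn_ord j)) /=.
rewrite !mul0r addr0 add0r.
case: eqP => [j0|_]; last by rewrite !mul0r.
case: eqP => [j1|_]; last by rewrite mul0r mulr0.
have K1 : K a = 1%N by rewrite -j1 j0.
case: (pickP (fun b => r0 b == a)) => [b /eqP b0|no0]; last first.
  by rewrite big_pred0 ?mulr0 ?mul0r.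
case: (pickP (fun c => r1 c == a)) => [c /eqP c1|no1]; last first.
  by rewrite [X in _ * (_ * X)]big_pred0 ?mulr0.
by case: (disj K1 b c).
Qed.

End Pushing.

Section Copies.
Variables (r : nat) (L : 'I_r -> int) (K : 'I_r -> nat).

Definition same_summand (a b : 'I_r) : bool := (L b == L a) && (K b == K a).

(** Lower masses will be gathered in the first copy of a summand and upper masses in the last. *)
Definition first_copy (a : 'I_r) : 'I_r := [arg min_(b < a | same_summand a b) b].
Definition last_copy (a : 'I_r) : 'I_r := [arg max_(b > a | same_summand a b) b].

Lemma same_summandxx a : same_summand a a.
Proof. by rewrite /same_summand !eqxx. Qed.

Lemma first_copyP a : [/\ L (first_copy a) = L a, K (first_copy a) = K a &
  forall b, L b = L a -> K b = K a -> (first_copy a <= b)%N].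
Proof.
rewrite /first_copy; case: arg_minnP => [|c /andP[/eqP-> /eqP->] cmin].
  exact: same_summandxx.
by split=> // b Lb Kb; apply: cmin; rewrite /same_summand Lb Kb !eqxx.
Qed.

Lemma last_copyP a : [/\ L (last_copy a) = L a, K (last_copy a) = K a &
  forall b, L b = L a -> K b = K a -> (b <= last_copy a)%N].
Proof.
rewrite /last_copy; case: arg_maxnP => [|c /andP[/eqP-> /eqP->] cmax].
  exact: same_summandxx.
by split=> // b Lb Kb; apply: cmax; rewrite /same_summand Lb Kb !eqxx.
Qed.

(** A summand that is both first and last among its copies is the only one, whereas genericity
    provides two copies [d < e]. *)
Lemma first_neq_last a : generic_rep L K -> K a = 1%N ->
  forall b c, first_copy b = a -> last_copy c = a -> False.
Proof.
move=> gen Ka b c ba ca.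
have [Lb Kb bmin] := first_copyP b; have [Lc Kc cmax] := last_copyP c.
rewrite ba in Lb Kb bmin; rewrite ca in Lc Kc cmax.
have [|d [e [de [Ld Kd] [Le Ke]]]] := gen (L a); first by exists a; rewrite Ka.
have ad : (a <= d)%N by apply: bmin; rewrite ?Ld ?Kd -?Lb -?Kb ?Ka.
have ea : (e <= a)%N by apply: cmax; rewrite ?Le ?Ke -?Lc -?Kc ?Ka.
by have := leq_trans (leq_trans de ea) ad; rewrite ltnn.
Qed.

End Copies.

Lemma Phi_hom_diagonalize (R : realType) r (L : 'I_r -> int) (K : 'I_r -> nat)
    (Z : @Wspace R r K) : generic_rep L K ->
  exists2 Z' : @Wspace R r K, sqnorm Z' = sqnorm Z &
    Phi_hom L Z' = diag_mx (\row_i Phi_hom L Z i i).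
Proof.
move=> gen; pose P a (j : 'I_(K a).+1) : R[i] := `|submxcol Z a j 0| ^+ 2.
pose r0 := first_copy L K; pose r1 := last_copy L K.
have r0L a : L (r0 a) = L a by have [] := first_copyP L K a.
have r0K a : K (r0 a) = K a by have [] := first_copyP L K a.
have r1L a : L (r1 a) = L a by have [] := last_copyP L K a.
have r1K a : K (r1 a) = K a by have [] := last_copyP L K a.
have P0 a (j : 'I_(K a).+1) : 0 <= push r0 r1 P j :> R[i].
  by apply: push_ge0 => b i; rewrite exprn_ge0.
(* Only the moduli matter, so nonnegative square roots of the pushed masses serve as coordinates. *)
pose z' a : 'cV[R[i]]_(K a).+1 := \col_j sqrtC (push r0 r1 P j).
have z'E a j : `|z' a j 0| ^+ 2 = push r0 r1 P j.
  by rewrite mxE -normrX sqrtCK ger0_norm.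
have sumE (x y : 'I_r -> R[i]) : (forall a, x (r0 a) = x a) ->
    (forall a, x (r1 a) = x a) -> (forall a, y (r1 a) = y a) ->
    \sum_a \sum_(j < (K a).+1) (x a + y a * j%:R) * `|z' a j 0| ^+ 2 =
    \sum_a \sum_(j < (K a).+1) (x a + y a * j%:R) * `|submxcol Z a j 0| ^+ 2.
  move=> x0 x1 y1; rewrite -(push_sum P x0 x1 y1 r1K).
  by apply: eq_bigr => a _; apply: eq_bigr => j _; rewrite z'E.
pose Z' : @Wspace R r K := \mxcol_a z' a.
have sqZ' : sqnorm Z' = sqnorm Z.
  rewrite !sqnorm_submxcol.
  (* The total mass is the case of the constant weight [1]. *)
  have := sumE (fun=> 1) (fun=> 0) (fun=> erefl) (fun=> erefl) (fun=> erefl).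
  under eq_bigr => a _ do under eq_bigr => j _ do rewrite mul0r addr0 mul1r.
  under [RHS]eq_bigr => a _ do under eq_bigr => j _ do rewrite mul0r addr0 mul1r.
  by move=> sE; rewrite -[RHS]sE; apply: eq_bigr => a _; rewrite mxcolK.
exists Z' => //; apply/matrixP => i j.
have z'diag a : is_diag_mx (Phi_block L (submxcol Z' a)).
  rewrite mxcolK; apply: Phi_block_diag => k; rewrite !mxE -rootCMl //.
  by rewrite push_consecutive ?rootC0 //; apply: first_neq_last.
have [<-|ij] := eqVneq i j; last first.
  rewrite !mxE (negPf ij) mulr0n summxE [X in _ * X]big1 ?mulr0 // => a _.
  by move/is_diag_mxP: (z'diag a); apply.
rewrite mxE [RHS]mxE eqxx mulr1n [RHS]mxE [RHS]mxE sqZ' !summxE; congr (_ * _).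
under eq_bigr => a _ do rewrite mxcolK.
case: (@split_ordP 1 1 i) => i' ->; rewrite ord1.
  under eq_bigr => a _ do rewrite Phi_block00.
  under [RHS]eq_bigr => a _ do rewrite Phi_block00.
  by apply: (sumE _ (fun=> -1)) => // a; rewrite ?r0L ?r0K ?r1L ?r1K.
under eq_bigr => a _ do rewrite Phi_block11.
under [RHS]eq_bigr => a _ do rewrite Phi_block11.
by apply: (sumE _ (fun=> 1)) => // a; rewrite ?r0L ?r1L.
Qed.

Theorem corollary2p9 (R : realType) (r : nat) (hr : (1 <= r)%N)
    (L : 'I_r -> int) (K : 'I_r -> nat) (hgen : generic_rep L K) :
  range (@Psi R r L K) = range (@Phi R r L K) `&` @t2 R.
Proof.
apply/seteqP; split=> A.
- move=> [p _ <-]; split; last exact: Psi_in_t2.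
  have [Z' sqZ' PhiZ'] := Phi_hom_diagonalize (repr_vec p) hgen.
  (* Equality of norms ensures that [Z'] defines a point of projective space. *)
  have Z'0 : Z' != 0 by rewrite -sqnorm_eq0 sqZ' sqnorm_eq0 repr_vec_neq0.
  by exists (proj_class Z'0) => //; rewrite Phi_class.
(* Conversely, a diagonal value of [Phi] equals its own diagonal part, so the same point works. *)
- move=> [[p _ <-] [_ /is_diag_mxP diag]]; exists p => //.
  apply/matrixP => i j; rewrite mxE [X in X *+ _]mxE.
  by have [<-|ij] := eqVneq i j; rewrite ?mulr1n // mulr0n diag.
Qed.
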